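(* Let $0\le i\le k$ be integers and $0\le r\le d$ integers. Let $\mathcal{O}\subseteq\mathbb{R}^k$ be a $(k,i)$-orange whose medial simplex $\tau$ lies in the coordinate subspace $\{x_1=\cdots=x_i=0\}$, and let $\mathcal{C}=\{\pi(\sigma)\colon \sigma\in\mathcal{O}\}\subseteq\mathbb{R}^i$ be its projected orange, where $\pi(x_1,\dots,x_k)=(x_1,\dots,x_i)$. Then \[ \dim S^{r}_{d}(\mathcal{O})=\sum_{j=0}^{d}\binom{d+k-i-j-1}{k-i-1}\dim S^{r}_{j}(\mathcal{C}). \]
   Context: A $(k,i)$-orange is a pure $k$-dimensional geometric simplicial complex $\mathcal{O}$ in $\mathbb{R}^k$ (all maximal faces $k$-simplices), with finitely many maximal faces, such that there is exactly one face $\tau$ of dimension $k-i$ contained in every maximal face of $\mathcal{O}$; $\tau$ is called the medial simplex. The projected orange $\mathcal{C}$ is the collection of images $\pi(\sigma)$ of the faces $\sigma$ of $\mathcal{O}$; it is an $i$-dimensional simplicial complex in $\mathbb{R}^i$. For a pure $m$-dimensional simplicial complex $\Delta$ in $\mathbb{R}^m$, $S^r_d(\Delta)$ denotes the real vector space of functions on the union of the simplices of $\Delta$ that are $C^r$-smooth and whose restriction to each maximal simplex is a polynomial of degree at most $d$. Binomial coefficients with lower index $-1$ (case $i=k$) follow the convention $\binom{-1}{-1}=1$ and $\binom{m}{-1}=0$ for $m\ge 0$, so that the formula reads $\dim S^r_d(\mathcal{O})=\dim S^r_d(\mathcal{C})$ when $i=k$. *)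

(* Defs.v *)
From HB Require Import structures.
From mathcomp Require Import all_boot all_order all_algebra finmap.
From mathcomp Require Import all_classical all_reals all_analysis.
From mathcomp Require mpoly.
(* The notations of mpoly clash with those of the analysis library. *)
Import -(notations) mpoly.

Set Implicit Arguments.
Unset Strict Implicit.
Unset Printing Implicit Defensive.

Import Order.TTheory GRing.Theory Num.Theory.
Import numFieldNormedType.Exports.

Local Open Scope classical_set_scope.
Local Open Scope ring_scope.

Section Dimension.
Variables (R : fieldType) (V : lmodType R).

Definition is_basis (S : set V) (n : nat) (b : 'I_n -> V) : Prop :=
  (forall c : 'rV[R]_n, \sum_(j < n) c 0 j *: b j = 0 -> c = 0) /\
  S = [set v | exists c : 'rV[R]_n, v = \sum_(j < n) c 0 j *: b j].

Definition has_dim (S : set V) (n : nat) : Prop :=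
  exists b : 'I_n -> V, is_basis S b.

Definition finite_dim (S : set V) : Prop := exists n, has_dim S n.

(* Junk value 0 when S has no finite basis. *)
Definition dimension (S : set V) : nat := xget 0%N [set n | has_dim S n].

Lemma has_dim_leq (S : set V) (m n : nat) :
  has_dim S m -> has_dim S n -> (m <= n)%N.
Proof.
move=> [b [bfree bS]] [e [_ eS]].
have /choice[A bA] (i : 'I_m) :
    exists c : 'rV[R]_n, b i = \sum_(j < n) c 0 j *: e j.
  have : S (b i).
    rewrite bS; exists (delta_mx 0 i).
    rewrite (bigD1 i) //= mxE !eqxx scale1r big1 ?addr0 // => j /negPf ji.
    by rewrite mxE ji andbF scale0r.
  by rewrite eS.
pose M : 'M[R]_(m, n) := \matrix_(i, j) A i 0 j.
have /eqP <- : row_free M.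
  rewrite -kermx_eq0; apply/eqP/row_matrixP => i; rewrite row0.
  apply: bfree; set c := row i _.
  have cM : c *m M = 0 by apply/eqP; rewrite -sub_kermx row_sub.
  under eq_bigr => j _ do rewrite bA scaler_sumr.
  rewrite exchange_big big1 //= => l _.
  under eq_bigr => j _ do rewrite scalerA.
  rewrite -scaler_suml.
  have -> : \sum_j c 0 j * A j 0 l = (c *m M) 0 l.
    by rewrite mxE; apply: eq_bigr => j _; rewrite !mxE.
  by rewrite cM mxE scale0r.
exact: rank_leq_col.
Qed.

Lemma dimensionE (S : set V) (n : nat) : has_dim S n -> dimension S = n.
Proof.
move=> Sn; have Sd : has_dim S (dimension S) by apply: (xgetPex 0%N); exists n.
by apply/eqP; rewrite eqn_leq !(@has_dim_leq S).
Qed.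

End Dimension.

Section SimplicialComplexes.
Variables (R : realType) (m : nat).
Implicit Types (V W : {fset 'rV[R]_m}) (sigma tau phi : set 'rV[R]_m).
Implicit Type (Delta : set (set 'rV[R]_m)).

Definition affinely_independent V : Prop :=
  forall c : 'rV[R]_m -> R,
    \sum_(v <- V) c v = 0 -> \sum_(v <- V) c v *: v = 0 ->
    forall v, v \in V -> c v = 0.

Definition hull V : set 'rV[R]_m :=
  [set x | exists c : 'rV[R]_m -> R,
     [/\ forall v, v \in V -> 0 <= c v,
         \sum_(v <- V) c v = 1 &
         x = \sum_(v <- V) c v *: v]].

Definition is_simplex (n : nat) sigma : Prop :=
  exists V, [/\ affinely_independent V, #|` V| = n.+1 & sigma = hull V].

(* Faces are nonempty; the empty simplex is not used. *)
Definition is_face phi sigma : Prop :=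
  exists V W, [/\ affinely_independent V, (W `<=` V)%fset, W != fset0,
                  sigma = hull V & phi = hull W].

Record simplicial_complex Delta : Prop := SimplicialComplex {
  complex_simplex : forall sigma, Delta sigma -> exists n, is_simplex n sigma ;
  complex_face : forall sigma phi, Delta sigma -> is_face phi sigma -> Delta phi ;
  complex_cap : forall sigma tau, Delta sigma -> Delta tau ->
    sigma `&` tau !=set0 ->
    is_face (sigma `&` tau) sigma /\ is_face (sigma `&` tau) tau
}.

Definition maximal_face Delta : set (set 'rV[R]_m) :=
  [set sigma | Delta sigma /\
     forall tau, Delta tau -> sigma `<=` tau -> tau = sigma].

Definition pure (n : nat) Delta : Prop :=
  forall sigma, maximal_face Delta sigma -> is_simplex n sigma.

Definition polyhedron Delta : set 'rV[R]_m := \bigcup_(sigma in Delta) sigma.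

End SimplicialComplexes.

Section Oranges.
Variables (R : realType) (k i : nat).
Implicit Type (O : set (set 'rV[R]_k)).

Definition medial_simplex O (tau : set 'rV[R]_k) : Prop :=
  [/\ O tau, is_simplex (k - i) tau &
      forall sigma, maximal_face O sigma -> tau `<=` sigma].

Definition orange O : Prop :=
  [/\ simplicial_complex O, pure k O, finite_set (maximal_face O) &
      exists! tau, medial_simplex O tau].

Variable ik : (i <= k)%N.

Definition coord_proj (x : 'rV[R]_k) : 'rV[R]_i :=
  \row_(j < i) x 0 (widen_ord ik j).

Definition projected_orange O : set (set 'rV[R]_i) :=
  [set coord_proj @` sigma | sigma in O].

End Oranges.

Section Splines.
Variables (R : realType) (m : nat).

(* On an open set U: all iterated partial derivatives of order at most r exist
   and are continuous on U. *)
Fixpoint Cr_on (r : nat) (U : set 'rV[R]_m) (g : 'rV[R]_m -> R) : Prop :=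
  (forall x, U x -> {for x, continuous g}) /\
  if r is r'.+1 then
    forall j : 'I_m,
      (forall x, U x -> derivable g x (delta_mx 0 j)) /\
      Cr_on r' U (fun x => 'D_(delta_mx 0 j) g x)
  else True.

(* Smoothness on an arbitrary subset A: local C^r extension to open sets. *)
Definition Cr_smooth (r : nat) (A : set 'rV[R]_m) (f : A -> R) : Prop :=
  forall a : A, exists (U : set 'rV[R]_m) (g : 'rV[R]_m -> R),
    [/\ open U, U (val a), Cr_on r U g &
        forall x : A, U (val x) -> f x = g (val x)].

Definition spline (r d : nat) (Delta : set (set 'rV[R]_m)) :
    set (polyhedron Delta -> R^o) :=
  [set f | Cr_smooth r f /\
     forall sigma, maximal_face Delta sigma ->
       exists p : mpoly m R, (mpoly.msize p <= d.+1)%N /\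
         forall x : polyhedron Delta, sigma (val x) ->
           f x = meval (fun j => val x 0 j) p].

End Splines.
Arguments spline {R m} r d Delta.

(* Binomial coefficient with 'C(-1, -1) = 1 and 'C(n, -1) = 0 for n >= 0
   (Negz 0 is -1); the remaining negative cases never occur. *)
Definition binz (n m : int) : nat :=
  match n, m with
  | Posz a, Posz b => 'C(a, b)
  | Negz 0, Negz 0 => 1
  | _, _ => 0
  end%N.

(* Main.v *)
(** Put [k = i + n] and write points of [R^k] as [(x, y)] with [x] in [R^i] and
    [y] in [R^n].  The splines of degree [d] on the orange [O] are exactly the
    sums of [f_a(x) y^a] over the multi-indices [a] with [|a| <= d], where [f_a]
    is a spline of degree [d - |a|] on the projected orange [C], and the [f_a]
    are unique; the formula then follows by counting the multi-indices of each
    degree.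

    To recover the [f_a] from [f], take a point [(0, y0)] in the relative
    interior of the medial simplex.  Maximal faces are convex and contain the
    medial simplex, so [(mu x, y0 + t)] lies in every maximal face above [x] as
    soon as [mu >= 0] and [t] are small.  On such a face [f] is a polynomial, so
    that interpolation in [t] isolates the coefficient of [y^a], and
    extrapolation in [mu] from small nodes to [mu = 1] gives [f_a(x)] as a fixed
    linear combination of values of [f] near the single point [(0, y0)].  Hence
    one local C^r extension of [f] around [(0, y0)] yields a C^r extension of
    [f_a] to a neighbourhood of the whole of [C]. *)

From HB Require Import structures.
Require Import Defs.
From mathcomp Require Import all_boot all_order all_algebra finmap.
From mathcomp Require Import all_classical all_reals all_analysis.
From mathcomp Require Import zify lra.
From mathcomp Require mpoly.
Import -(notations) mpoly.

Set Implicit Arguments.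
Unset Strict Implicit.
Unset Printing Implicit Defensive.

Import Order.TTheory GRing.Theory Num.Theory.
Import numFieldNormedType.Exports.

Local Open Scope classical_set_scope.
Local Open Scope ring_scope.

(** * Dimension and counting *)

Section FiniteDimension.
Variables (K : fieldType) (V : lmodType K).
Implicit Type S : set V.

Lemma has_dim_card (I : finType) S (b : I -> V) :
  (forall c : I -> K, \sum_j c j *: b j = 0 -> forall j, c j = 0) ->
  (forall v, S v <-> exists c : I -> K, v = \sum_j c j *: b j) ->
  has_dim S #|I|.
Proof.
have E (c : 'rV[K]_#|I|) :
    \sum_(j < #|I|) c 0 j *: b (enum_val j) =
    \sum_j c 0 (enum_rank j) *: b j.
  rewrite (reindex enum_rank) /=; last exact: onW_bij (@enum_rank_bij _).
  by apply: eq_bigr => j _; rewrite enum_rankK.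
move=> bfree bS; exists (fun j => b (enum_val j)); split.
  move=> c; rewrite E => /bfree c0; apply/rowP => j.
  by rewrite mxE -(c0 (enum_val j)) enum_valK.
apply/seteqP; split=> v /=.
  move=> /bS[c ->]; exists (\row_j c (enum_val j)).
  by rewrite E; apply: eq_bigr => j _; rewrite mxE enum_rankK.
by move=> [c ->]; rewrite E; apply/bS; exists (fun j => c 0 (enum_rank j)).
Qed.

Let free_family n (b : 'I_n -> V) :=
  forall c : 'rV[K]_n, \sum_(j < n) c 0 j *: b j = 0 -> c = 0.

(** A vector in the left kernel of the coordinate matrix of [b] with respect to [e] gives a linear
    relation among the [b j]. Freeness makes the rank equal to [n], and the rank is at most the
    number of columns. *)
Let free_family_leq (I : finType) (e : I -> V) n (b : 'I_n -> V) :
  (forall j, exists c : I -> K, b j = \sum_l c l *: e l) ->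
  free_family b -> (n <= #|I|)%N.
Proof.
move=> /choice[A bA] bfree.
pose M : 'M[K]_(n, #|I|) := \matrix_(i, j) A i (enum_val j).
have /eqP <- : row_free M.
  rewrite -kermx_eq0; apply/eqP/row_matrixP => i; rewrite row0.
  apply: bfree; set c := row i _.
  have cM : c *m M = 0 by apply/eqP; rewrite -sub_kermx row_sub.
  under eq_bigr => j _ do rewrite bA scaler_sumr.
  rewrite exchange_big big1 //= => l _.
  under eq_bigr => j _ do rewrite scalerA.
  rewrite -scaler_suml.
  have -> : \sum_j c 0 j * A j l = (c *m M) 0 (enum_rank l).
    by rewrite mxE; apply: eq_bigr => j _; rewrite !mxE enum_rankK.
  by rewrite cM mxE scale0r.
exact: rank_leq_col.
Qed.

(** The size of a free family in [S] is bounded by [#|I|], so one of maximal size exists, and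
    maximality makes it a basis. The [e j] may lie outside [S]. *)
Lemma finite_dim_sub_span (I : finType) S (e : I -> V) :
  S 0 -> (forall a u v, S u -> S v -> S (a *: u + v)) ->
  (forall v, S v -> exists c : I -> K, v = \sum_j c j *: e j) ->
  finite_dim S.
Proof.
move=> S0 SL Se.
pose P n := `[< exists b : 'I_n -> V, free_family b /\ forall j, S (b j) >].
have P0 : exists n, P n.
  exists 0%N; apply/asboolP; exists (fun=> 0); split=> [c _|[]//].
  by apply/rowP => -[].
have Pmax n : P n -> (n <= #|I|)%N.
  move=> /asboolP[b [bfree bS]]; apply: (free_family_leq _ bfree) => j.
  exact: Se.
case: (ex_maxnP P0 Pmax) => n /asboolP[b [bfree bS]] nmax.
exists n, b; split=> //; apply/seteqP; split=> v /=; last first.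
  move=> [c ->]; elim/big_ind: _ => // [u w Su Sw|j _].
    by rewrite -[u]scale1r; apply: SL.
  by rewrite -[_ *: _]addr0; apply: SL.
move=> Sv.
(* Adjoining [v] to the maximal free family destroys freeness. The resulting relation has a nonzero
   coefficient at [v], since otherwise it would be a relation among the [b j]; hence it can be
   solved for [v]. *)
pose b' (j : 'I_n.+1) := oapp b v (unlift ord0 j).
have [b'free|] := pselect (free_family b').
  have /nmax : P n.+1.
    apply/asboolP; exists b'; split=> // j.
    by rewrite /b'; case: unliftP => [l _|_] /=.
  by rewrite ltnn.
move=> /existsNP[c /not_implyP[c0 cN0]].
move: c0; rewrite big_ord_recl /b' unlift_none /=.
under eq_bigr => j _ do rewrite liftK /=.
move=> c0; have [c00|c0N0] := eqVneq (c 0 ord0) 0.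
  case: cN0; apply/rowP => j; rewrite mxE.
  case: (unliftP ord0 j) => [l ->|-> //].
  move: c0; rewrite c00 scale0r add0r => c0.
  have /rowP/(_ l) : \row_l c 0 (lift ord0 l) = 0.
    by apply: bfree; under eq_bigr do rewrite mxE.
  by rewrite !mxE.
exists (\row_j (- (c 0 ord0)^-1 * c 0 (lift ord0 j))).
under eq_bigr => j _ do rewrite mxE -scalerA.
rewrite -scaler_sumr; move/eqP: c0; rewrite addrC addr_eq0 => /eqP ->.
by rewrite scalerN scaleNr opprK scalerA mulVf // scale1r.
Qed.

(** Dimension of a direct sum: the images under [T a] of bases of the [U a], indexed by dependent
    pairs, form a basis of [S]. Joint injectivity is required only on families taken from the
    [U a]. *)
Lemma has_dim_bigsum (W : lmodType K) (A : finType) (T : A -> {linear W -> V})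
    (U : A -> set W) (n : A -> nat) S :
  (forall a, has_dim (U a) (n a)) ->
  (forall f, (forall a, U a (f a)) -> S (\sum_a T a (f a))) ->
  (forall v, S v -> exists2 f, forall a, U a (f a) & v = \sum_a T a (f a)) ->
  (forall f, (forall a, U a (f a)) -> \sum_a T a (f a) = 0 ->
    forall a, f a = 0) ->
  has_dim S (\sum_a n a).
Proof.
move=> dimU S_sum sum_S sum_inj.
have {dimU} [b bU] : exists b : forall a, 'I_(n a) -> W,
    forall a, is_basis (U a) (@b a).
  by exists (fun a => projT1 (cid (dimU a))) => a; case: cid.
have -> : (\sum_a n a)%N = #|{: {a : A & 'I_(n a)}}|.
  rewrite card_tagged sumnE big_map big_enum /=.
  by apply: eq_bigr => a _; rewrite card_ord.
have E (c : {a : A & 'I_(n a)} -> K) :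
    \sum_u c u *: T (tag u) (b (tag u) (tagged u)) =
    \sum_a T a (\sum_j c (Tagged (fun a => 'I_(n a)) j) *: b a j).
  under [RHS]eq_bigr => a _.
    rewrite linear_sum; under eq_bigr do rewrite linearZ; over.
  rewrite (sig_big_dep xpredT (fun _ => xpredT)
    (fun a j => c (Tagged (fun a => 'I_(n a)) j) *: T a (b a j))) /=.
  by apply: eq_bigr => -[a j] _.
have Ub (c : {a : A & 'I_(n a)} -> K) a :
    U a (\sum_j c (Tagged (fun a => 'I_(n a)) j) *: b a j).
  have [_ ->] := bU a; exists (\row_j c (Tagged (fun a => 'I_(n a)) j)).
  by apply: eq_bigr => j _; rewrite mxE.
apply: (@has_dim_card _ _ (fun u => T (tag u) (b (tag u) (tagged u)))).
  move=> c; rewrite E => /(sum_inj (fun a => _)) c0 [a j].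
  have [bfree _] := bU a.
  have c'0 : \row_j c (Tagged (fun a => 'I_(n a)) j) = 0 :> 'rV[K]_(n a).
    by apply: bfree; under eq_bigr do rewrite mxE; apply: c0 => a'.
  by have := congr1 (fun M : 'rV_(n a) => M 0 j) c'0; rewrite !mxE.
move=> v; split=> [/sum_S[f fU ->]|[c ->]]; last first.
  by rewrite E; apply: (S_sum (fun a => _)).
have fb a : exists c : 'rV[K]_(n a), f a = \sum_j c 0 j *: b a j.
  by have := fU a; have [_ ->] := bU a.
exists (fun u => projT1 (cid (fb (tag u))) 0 (tagged u)); rewrite E.
by apply: eq_bigr => a _ /=; case: cid => c /= <-.
Qed.

End FiniteDimension.

(** Stars and bars; the bound [e < b] ensures that the finite type contains every multi-index of
    degree [e]. *)
Lemma card_bmultinom_mdeg n b e : (e < b)%N ->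
  #|[pred m : bmultinom n b | mdeg m == e]| =
    binz (e%:Z + n%:Z - 1) (n%:Z - 1).
Proof.
move=> eb; case: n => [|n].
  (* In zero variables the empty multi-index, of degree 0, is the only one. The convention
     [binz (-1) (-1) = 1] and [binz m (-1) = 0] for [m >= 0] records exactly this. *)
  rewrite addr0 !sub0r /=; case: e eb => [|e] eb; last first.
    rewrite (_ : e.+1%:Z - 1 = e%:Z) /=; last by lia.
    by apply: eq_card0 => m; rewrite inE mdegE big_ord0.
  have m0b : (mdeg (@mnm0 0) < b)%N by rewrite mdeg0.
  rewrite (_ : binz _ _ = 1%N) // -(card1 (BMultinom m0b)).
  apply: eq_card => m.
  rewrite !inE mdegE big_ord0 eqxx; apply/esym/eqP/val_inj => /=.
  by apply/mnmP => -[].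
have -> : e%:Z + n.+1%:Z - 1 = (e + n)%N%:Z by lia.
have -> : n.+1%:Z - 1 = n%:Z by lia.
rewrite /= -bin_sub ?leq_addl // addnK -size_basis cardE -(size_map val).
apply/perm_size/uniq_perm.
- by rewrite (map_inj_uniq val_inj) enum_uniq.
- exact: uniq_basis.
move=> m; rewrite -basis_cover; apply/mapP/eqP => [[m' + ->]|me].
  by rewrite mem_enum inE => /eqP.
have mb : (mdeg m < b)%N by rewrite me.
by exists (BMultinom mb); rewrite // mem_enum inE /= me.
Qed.

(** The multi-indices are grouped by the remaining degree [j = d - mdeg m], which ranges over
    [0..d]. *)
Lemma sum_bmultinom n d (D : nat -> nat) :
  (\sum_(m : bmultinom n d.+1) D (d - mdeg m)%N =
   \sum_(0 <= j < d.+1)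
     binz (d%:Z + n%:Z - j%:Z - 1) (n%:Z - 1) * D j)%N.
Proof.
pose h (m : bmultinom n d.+1) : 'I_d.+1 := inord (d - mdeg m).
rewrite big_mkord (partition_big h xpredT) //=; apply: eq_bigr => j _.
have jd : (j <= d)%N by rewrite -ltnS.
have -> : d%:Z + n%:Z - j%:Z - 1 = (d - j)%N%:Z + n%:Z - 1 by lia.
rewrite -(@card_bmultinom_mdeg n d.+1) ?ltnS ?leq_subr //.
rewrite -sum1_card big_distrl /=.
have hE m : (h m == j) = (mdeg m == (d - j)%N).
  have md : (mdeg m <= d)%N by rewrite -ltnS bmdeg.
  by rewrite -val_eqE /h /= inordK ?ltnS ?leq_subr //; lia.
rewrite (eq_bigl _ _ hE); apply: eq_bigr => m /eqP ->.
by rewrite subKn // mul1n.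
Qed.

(** * Functions of class C^r *)

Section SmoothFunctions.
Variable R : realType.

Lemma Cr_on_subset m r (U U' : set 'rV[R]_m) g :
  U' `<=` U -> Cr_on r U g -> Cr_on r U' g.
Proof.
move=> U'U; elim: r g => [|r IH] g /= [gc gd].
  by split=> // x /U'U /gc.
split=> [x /U'U /gc //|j]; have [gj Dj] := gd j.
by split=> [x /U'U /gj //|]; apply: IH.
Qed.

Lemma Cr_onW m r (U : set 'rV[R]_m) g : Cr_on r.+1 U g -> Cr_on r U g.
Proof.
elim: r g => [|r IH] g [gc gd]; split=> // j; have [gj Dj] := gd j.
by split=> //; apply: IH.
Qed.

Lemma Cr_on_ext m r (U : set 'rV[R]_m) g h :
  g =1 h -> Cr_on r U g -> Cr_on r U h.
Proof. by move=> /funext ->. Qed.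

(** Openness of [U] turns equality on [U] into equality near each point of [U], which passes to
    limits and to partial derivatives. *)
Lemma eq_Cr_on m r (U : set 'rV[R]_m) g h : open U ->
  (forall x, U x -> g x = h x) -> Cr_on r U g -> Cr_on r U h.
Proof.
move=> oU.
have nearU (f k : 'rV[R]_m -> R) : (forall x, U x -> f x = k x) ->
    forall x, U x -> \forall y \near x, f y = k y.
  by move=> fk x Ux; apply: filterS (open_nbhs_nbhs (conj oU Ux)) => y /fk.
have contU (f k : 'rV[R]_m -> R) : (forall x, U x -> f x = k x) ->
    (forall x, U x -> {for x, continuous f}) ->
    forall x, U x -> {for x, continuous k}.
  move=> fk fc x Ux; rewrite /prop_for /continuous_at -(fk x Ux).
  exact: cvg_trans (near_eq_cvg (nearU _ _ fk _ Ux)) (fc x Ux).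
elim: r g h => [|r IH] g h gh /= [gc gd].
  by split=> //; apply: contU gc.
split=> [|j]; first exact: contU gc.
have [gj Dj] := gd j; split=> [x Ux|].
  by apply: near_eq_derivable (gj x Ux); apply: nearU.
apply: IH Dj => x Ux; apply: near_eq_derive; exact: nearU.
Qed.

Lemma Cr_on_cst m r (U : set 'rV[R]_m) (a : R) : Cr_on r U (fun=> a).
Proof.
elim: r a => [|r IH] a /=; split=> //.
- by move=> x _; apply: cst_continuous.
- by move=> x _; apply: cst_continuous.
move=> j; split=> [x _|]; first exact: derivable_cst.
by apply: Cr_on_ext (IH 0) => x; rewrite [RHS]derive_cst.
Qed.

Lemma Cr_onD m r (U : set 'rV[R]_m) g h : open U ->
  Cr_on r U g -> Cr_on r U h -> Cr_on r U (fun x => g x + h x).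
Proof.
move=> oU; elim: r g h => [|r IH] g h /= [gc gd] [hc hd].
  by split=> // x Ux; apply: continuousD; [apply: gc|apply: hc].
split=> [x Ux|j]; first by apply: continuousD; [apply: gc|apply: hc].
have [gj Dgj] := gd j; have [hj Dhj] := hd j; split=> [x Ux|].
  by apply: derivableD; [apply: gj|apply: hj].
apply: eq_Cr_on (IH _ _ Dgj Dhj) => // x Ux.
by rewrite -deriveD //; [apply: gj|apply: hj].
Qed.

(** The Leibniz rule expresses a derivative through products of a factor with a derivative of the
    other one; lowering the order of the undifferentiated factor by [Cr_onW] lets the induction
    hypothesis apply. *)
Lemma Cr_onM m r (U : set 'rV[R]_m) g h : open U ->
  Cr_on r U g -> Cr_on r U h -> Cr_on r U (fun x => g x * h x).
Proof.
move=> oU; elim: r g h => [|r IH] g h Cg Ch.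
  by split=> // x Ux; apply: continuousM; [apply: Cg.1|apply: Ch.1].
split=> [x Ux|j]; first by apply: continuousM; [apply: Cg.1|apply: Ch.1].
have [gj Dgj] := Cg.2 j; have [hj Dhj] := Ch.2 j; split=> [x Ux|].
  by apply: derivableM; [apply: gj|apply: hj].
have := Cr_onD oU (IH _ _ (Cr_onW Cg) Dhj) (IH _ _ (Cr_onW Ch) Dgj).
apply: eq_Cr_on => // x Ux.
by rewrite [RHS](deriveM (gj x Ux) (hj x Ux)).
Qed.

Lemma Cr_on_sum m r (U : set 'rV[R]_m) (I : Type) (s : seq I)
    (g : I -> 'rV[R]_m -> R) : open U ->
  (forall l, Cr_on r U (g l)) -> Cr_on r U (fun x => \sum_(l <- s) g l x).
Proof.
move=> oU Cg; elim: s => [|a s IH].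
  by apply: eq_Cr_on (Cr_on_cst r U 0) => // x _; rewrite big_nil.
apply: eq_Cr_on (Cr_onD oU (Cg a) IH) => // x _; by rewrite big_cons.
Qed.

Lemma Cr_on_prod m r (U : set 'rV[R]_m) (I : Type) (s : seq I)
    (g : I -> 'rV[R]_m -> R) : open U ->
  (forall l, Cr_on r U (g l)) -> Cr_on r U (fun x => \prod_(l <- s) g l x).
Proof.
move=> oU Cg; elim: s => [|a s IH].
  by apply: eq_Cr_on (Cr_on_cst r U 1) => // x _; rewrite big_nil.
apply: eq_Cr_on (Cr_onM oU (Cg a) IH) => // x _; by rewrite big_cons.
Qed.

Lemma Cr_onX m r (U : set 'rV[R]_m) g n : open U ->
  Cr_on r U g -> Cr_on r U (fun x => g x ^+ n).
Proof.
move=> oU Cg; elim: n => [|n IH].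
  by apply: eq_Cr_on (Cr_on_cst r U 1) => // x _; rewrite expr0.
apply: eq_Cr_on (Cr_onM oU Cg IH) => // x _; by rewrite exprS.
Qed.

Lemma derive_coord m (x v : 'rV[R]_m) (l : 'I_m) :
  is_derive x v (fun y : 'rV[R]_m => y 0 l) (v 0 l).
Proof.
have E : (fun h : R => h^-1 *:
    (((fun y : 'rV[R]_m => y 0 l) \o shift x) (h *: v) - x 0 l)) @ 0^' -->
    (v 0 l).
  apply: (cvg_trans (near_eq_cvg (f := fun=> v 0 l) _)); last exact: cvg_cst.
  near=> h; rewrite /= !mxE addrK.
  rewrite [_ *: _]mulrA mulVf ?mul1r //; near: h.
  exact: nbhs_dnbhs_neq.
split; first by apply/cvg_ex; exists (v 0 l).
exact: cvg_lim E.
Unshelve. all: by end_near. Qed.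

Lemma Cr_on_coord m r (U : set 'rV[R]_m) (l : 'I_m) :
  Cr_on r U (fun x => x 0 l).
Proof.
have cc (x : 'rV[R]_m) : {for x, continuous (fun x : 'rV[R]_m => x 0 l)}.
  exact: coord_continuous.
case: r => [|r]; split=> // j; split=> [x _|].
  by have [] := derive_coord x (delta_mx 0 j) l.
apply: Cr_on_ext (Cr_on_cst r U ((delta_mx 0 j : 'rV[R]_m) 0 l)) => x.
by have [_ ->] := derive_coord x (delta_mx 0 j) l.
Qed.

(** Chain rule along a single line: the difference quotient of the composite at [h] is [c] times
    that of [g] at [h * c]. As [c] is nonzero, [h * c] tends to 0 through nonzero values. *)
Lemma derive_comp_scale m n (A : 'rV[R]_m -> 'rV[R]_n) (g : 'rV[R]_n -> R)
    (c : R) (u : 'rV[R]_m) (v : 'rV[R]_n) (x : 'rV[R]_m) : c != 0 ->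
  (forall h : R, A (h *: u + x) = (h * c) *: v + A x) ->
  derivable g (A x) v ->
  is_derive x u (fun y => g (A y)) (c * 'D_v g (A x)).
Proof.
move=> c0 Ac dg.
have cvgc : (fun h : R => h * c) @ 0^' --> (0 : R)^'.
  move=> P [e e0 Pe]; exists (e / `|c|).
    by rewrite /= divr_gt0 // normr_gt0.
  move=> h /= hb h0; apply: Pe; last by rewrite mulf_neq0.
  move: hb; rewrite /ball_ /= !sub0r !normrN normrM ltr_pdivlMr // normr_gt0 //.
have E : (fun h : R => h^-1 *:
    (((fun y => g (A y)) \o shift x) (h *: u) - g (A x))) @ 0^' -->
    (c * 'D_v g (A x)).
  have -> : (fun h : R => h^-1 *:
      (((fun y => g (A y)) \o shift x) (h *: u) - g (A x))) =
    (fun h => c * (((fun h => h^-1 *: ((g \o shift (A x)) (h *: v) - g (A x)))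
      \o (fun h => h * c)) h)).
    apply/funext => h /=; rewrite Ac; set D := g _ - _.
    change (h^-1 * D = c * ((h * c)^-1 * D)).
    by rewrite invfM mulrA mulrCA mulfV // mulr1.
  apply: cvgMl_tmp.
  apply: cvg_comp cvgc _; exact: dg.
by split; [apply/cvg_ex; eexists; exact: E|exact: cvg_lim E].
Qed.

(** Each coordinate direction is either collapsed by [A] or sent to a nonzero multiple of a
    coordinate direction, so a partial derivative of the composite is 0 or a constant times a
    partial derivative of [g], and induction on [r] applies. Both [lsubmx] and the maps sending [x]
    to [(mu x, y + t)] with [mu > 0] have this form. *)
Lemma Cr_on_comp m n r (U : set 'rV[R]_n) (A : 'rV[R]_m -> 'rV[R]_n) g :
  open U -> continuous A ->
  (forall j, (forall (h : R) x, A (h *: delta_mx 0 j + x) = A x) \/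
     exists c l, c != 0 /\ forall (h : R) x,
       A (h *: delta_mx 0 j + x) = (h * c) *: delta_mx 0 l + A x) ->
  Cr_on r U g -> Cr_on r (A @^-1` U) (fun x => g (A x)).
Proof.
move=> oU cA Aj; have oAU : open (A @^-1` U) by apply: open_comp.
elim: r g => [|r IH] g Cg; split=> //.
- by move=> x Ux; apply: continuous_comp; [exact: cA|exact: Cg.1].
- by move=> x Ux; apply: continuous_comp; [exact: cA|exact: Cg.1].
move=> j; have [A0|[c [l [c0 Al]]]] := Aj j.
  have D0 x : is_derive x (delta_mx 0 j) (fun y => g (A y)) 0.
    have E : (fun h : R => h^-1 *: (((fun y => g (A y)) \o shift x)
        (h *: delta_mx 0 j) - g (A x))) @ 0^' --> (0 : R).
      rewrite (_ : (fun _ => _) = fun=> 0); first exact: cvg_cst.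
      by apply/funext => h /=; rewrite A0 subrr scaler0.
    by split; [apply/cvg_ex; eexists; exact: E|exact: cvg_lim E].
  split=> [x _|]; first by have [] := D0 x.
  by apply: Cr_on_ext (Cr_on_cst _ _ 0) => x; have [_ ->] := D0 x.
have [gl Dl] := Cg.2 l.
have D x : U (A x) -> is_derive x (delta_mx 0 j) (fun y => g (A y))
    (c * 'D_(delta_mx 0 l) g (A x)).
  by move=> Ux; apply: derive_comp_scale => //; apply: gl.
split=> [x Ux|]; first by have [] := D x Ux.
apply: eq_Cr_on (Cr_onM oAU (Cr_on_cst _ _ c) (IH _ Dl)) => // x Ux.
by have [_ ->] := D x Ux.
Qed.

End SmoothFunctions.

(** * Simplices *)

Section MatrixNorm.
Variable R : realType.

Lemma ler_coord_norm m n (x : 'M[R]_(m, n)) j l : `|x j l| <= `|x|.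
Proof.
rewrite [leRHS]/Num.Def.normr /= mx_normrE.
by apply/bigmax_geP; right => /=; exists (j, l).
Qed.

Lemma norm_le_coord m n (x : 'M[R]_(m, n)) (e : R) :
  0 <= e -> (forall j l, `|x j l| <= e) -> `|x| <= e.
Proof.
move=> e0 xe; rewrite /Num.Def.normr /= mx_normrE.
by apply/bigmax_leP; split=> // -[j l] _ /=.
Qed.

Lemma norm_lsubmx m n1 n2 (x : 'M[R]_(m, n1 + n2)) : `|lsubmx x| <= `|x|.
Proof. by apply: norm_le_coord => // j l; rewrite mxE ler_coord_norm. Qed.

Lemma norm_rsubmx m n1 n2 (x : 'M[R]_(m, n1 + n2)) : `|rsubmx x| <= `|x|.
Proof. by apply: norm_le_coord => // j l; rewrite mxE ler_coord_norm. Qed.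

End MatrixNorm.

Section Hulls.
Variables (R : realType) (m : nat).
Implicit Types V W : {fset 'rV[R]_m}.

Lemma hull_vertex V v : v \in V -> hull V v.
Proof.
move=> vV; exists (fun w => (w == v)%:R); split=> [w _||].
- exact: ler0n.
- rewrite (bigD1_seq v) //= eqxx big1 ?addr0 // => w /negPf -> //.
- rewrite (bigD1_seq v) //= eqxx scale1r big1 ?addr0 // => w /negPf ->.
  by rewrite scale0r.
Qed.

Lemma hull_convex V p q (a : R) : 0 <= a <= 1 ->
  hull V p -> hull V q -> hull V (a *: p + (1 - a) *: q).
Proof.
move=> /andP[a0 a1] [c [c0 c1 ->]] [e [e0 e1 ->]].
exists (fun v => a * c v + (1 - a) * e v); split=> [v vV||].
- by rewrite addr_ge0 // mulr_ge0 ?subr_ge0 //; [apply: c0|apply: e0].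
- by rewrite big_split /= -!mulr_sumr c1 e1 !mulr1 addrC subrK.
- rewrite !scaler_sumr -big_split /=; apply: eq_bigr => v _.
  by rewrite !scalerA -scalerDl.
Qed.

Lemma hull_bounded V : exists M : R, forall x, hull V x -> `|x| <= M.
Proof.
exists (\sum_(v <- V) `|v|) => _ [c [c0 c1 ->]].
apply: le_trans (ler_norm_sum _ _ _) _.
rewrite big_seq [leRHS]big_seq; apply: ler_sum => v vV.
rewrite normrZ ger0_norm ?c0 // ler_piMl // -c1 (bigD1_seq v) //= lerDl.
by rewrite big_seq_cond; apply: sumr_ge0 => w /andP[wV _]; apply: c0.
Qed.

Lemma hull_neq0 V : V != fset0 -> hull V !=set0.
Proof. by move=> /fset0Pn[v vV]; exists v; apply: hull_vertex. Qed.

(** Common source of the rank arguments below: a left kernel vector of the matrix is a relation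
    among the [a v], which the hypothesis converts into an affine relation among the vertices. *)
Lemma affinely_independent_row_free V n (a : 'rV[R]_m -> 'rV[R]_n) :
  affinely_independent V ->
  (forall c : 'rV[R]_m -> R, \sum_(v <- V) c v *: a v = 0 ->
     \sum_(v <- V) c v = 0 /\ \sum_(v <- V) c v *: v = 0) ->
  row_free (\matrix_(j < #|{: V}|) a (val (enum_val j))).
Proof.
move=> indV aV; set M := \matrix_(j < _) _.
rewrite -kermx_eq0; apply/eqP/row_matrixP => i; rewrite row0.
set c := row i _.
have cM : c *m M = 0 by apply/eqP; rewrite -sub_kermx row_sub.
pose c' v := oapp (fun u : V => c 0 (enum_rank u)) 0 (insub v).
have c'E (u : V) : c' (val u) = c 0 (enum_rank u) by rewrite /c' valK.
have c'0 : \sum_(v <- V) c' v *: a v = 0.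
  rewrite big_seq_fsetE /= -[RHS]cM mulmx_sum_row.
  rewrite [RHS](reindex enum_rank) /=; last exact: onW_bij (@enum_rank_bij _).
  by apply: eq_bigr => u _; rewrite c'E rowK enum_rankK.
have [s0 v0] := aV _ c'0.
apply/rowP => j; rewrite [RHS]mxE -(indV _ s0 v0 (val (enum_val j)) (valP _)).
by rewrite c'E enum_valK.
Qed.

(** Homogenisation: the vectors [(1, v)] are linearly independent in a space of dimension
    [m + 1]. *)
Lemma affinely_independent_leq V : affinely_independent V ->
  (#|` V| <= m.+1)%N.
Proof.
move=> indV; pose a (v : 'rV[R]_m) := row_mx (1%:M : 'M[R]_1) v.
have /eqP : row_free (\matrix_(j < #|{: V}|) a (val (enum_val j))).
  apply: affinely_independent_row_free => // c.
  under eq_bigr do rewrite scale_row_mx.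
  move=> c0; split; last first.
    have := congr1 (@rsubmx _ _ _ _) c0; rewrite linear_sum linear0 /= => E.
    rewrite -[RHS]E.
    by apply: eq_bigr => v _; rewrite row_mxKr.
  have := congr1 (fun A : 'rV[R]_(1 + m) => lsubmx A 0 0) c0.
  rewrite /= linear_sum linear0 /= summxE mxE => E; rewrite -[RHS]E.
  by apply: eq_bigr => v _; rewrite row_mxKl !mxE mulr1.
by rewrite cardfE => <-; apply: rank_leq_col.
Qed.

Lemma hull_card_leq V W : affinely_independent V -> hull V `<=` hull W ->
  (#|` V| <= #|` W|)%N.
Proof.
move=> indV VW.
have /choice[A AE] v : exists c : 'rV[R]_m -> R, v \in V ->
    \sum_(w <- W) c w = 1 /\ v = \sum_(w <- W) c w *: w.
  have [vV|_] := boolP (v \in V); last by exists (fun=> 0).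
  by have [c [_ c1 cv]] := VW _ (hull_vertex vV); exists c.
pose a (v : 'rV[R]_m) : 'rV[R]_#|{: W}| := \row_j A v (val (enum_val j)).
have /eqP : row_free (\matrix_(j < #|{: V}|) a (val (enum_val j))).
  apply: affinely_independent_row_free => // c c0.
  have {}c0 w : w \in W -> \sum_(v <- V) c v * A v w = 0.
    move=> wW.
    have := congr1 (fun M : 'rV_#|{: W}| => M 0 (enum_rank [` wW]%fset)) c0.
    rewrite summxE mxE => E; rewrite -[RHS]E; apply: eq_bigr => v _.
    by rewrite !mxE enum_rankK.
  split.
    transitivity (\sum_(v <- V) \sum_(w <- W) c v * A v w).
      rewrite big_seq [RHS]big_seq; apply: eq_bigr => v vV.
      by rewrite -mulr_sumr (AE v vV).1 mulr1.
    by rewrite exchange_big big_seq big1.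
  transitivity (\sum_(v <- V) \sum_(w <- W) (c v * A v w) *: w).
    rewrite big_seq [RHS]big_seq; apply: eq_bigr => v vV.
    rewrite [X in _ *: X = _](AE v vV).2 scaler_sumr.
    by apply: eq_bigr => w _; rewrite scalerA.
  rewrite exchange_big big_seq big1 // => w wW.
  by rewrite -scaler_suml c0 // scale0r.
by rewrite !cardfE => <-; apply: rank_leq_col.
Qed.

(** Numbers of vertices are bounded by [m + 1], so some simplex containing [sigma] has the most. If
    [rho] contains it, it is their intersection and hence a face of [rho]; having at least as many
    vertices, it is all of [rho]. *)
Lemma complex_sub_maximal_face (Delta : set (set 'rV[R]_m)) sigma :
  simplicial_complex Delta -> Delta sigma ->
  exists2 rho, maximal_face Delta rho & sigma `<=` rho.
Proof.
move=> [Dsimp Dface Dcap] Ds.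
pose P n := `[< exists V, [/\ affinely_independent V, #|` V| = n,
                            Delta (hull V) & sigma `<=` hull V] >].
have Pex : exists n, P n.
  have [n [V [indV _ sV]]] := Dsimp _ Ds.
  by exists #|` V|; apply/asboolP; exists V; split; rewrite -?sV.
have Pmax n : P n -> (n <= m.+1)%N.
  by move=> /asboolP[V [indV <- _ _]]; apply: affinely_independent_leq.
have s0 : sigma !=set0.
  have [n [V [_ Vn ->]]] := Dsimp _ Ds; apply: hull_neq0.
  by rewrite -cardfs_eq0 Vn.
case: (ex_maxnP Pex Pmax) => n /asboolP[V [indV Vn DV sV]] nmax.
exists (hull V) => //; split=> // rho Drho Vrho.
have V0 : hull V `&` rho !=set0.
  by have [x sx] := s0; exists x; split; [apply: sV|apply/Vrho/sV].
have [_ [V2 [W2 [indV2 W2V2 _ rhoE]]]] := Dcap _ _ DV Drho V0.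
rewrite (setIidl Vrho) => VW2.
have le1 : (#|` V2| <= n)%N.
  apply: nmax; apply/asboolP; exists V2; split=> //; rewrite -rhoE //.
  by apply: subset_trans Vrho.
have le2 : (n <= #|` W2|)%N by rewrite -Vn hull_card_leq // VW2.
have V2W2 : V2 = W2.
  by apply/eqP; rewrite eq_sym eqEfcard W2V2 /= (leq_trans le1).
by rewrite rhoE V2W2 -VW2.
Qed.

End Hulls.

(** The rows [(1, y-part of v)] form an invertible square matrix, whose inverse gives barycentric
    coordinates. At the barycenter they all equal [1/(n+1)], so they stay nonnegative under small
    displacements within the subspace where the first block vanishes. *)
Lemma simplex_relative_ball (R : realType) i n (V : {fset 'rV[R]_(i + n)}) :
  affinely_independent V -> #|` V| = n.+1 ->
  (forall v, v \in V -> lsubmx v = 0) ->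
  exists (y : 'rV[R]_n) (e : R), 0 < e /\
    forall t : 'rV[R]_n, `|t| <= e -> hull V (row_mx 0 (y + t)).
Proof.
move=> indV Vn V0.
pose a (v : 'rV[R]_(i + n)) := row_mx (1%:M : 'M[R]_1) (rsubmx v).
set M := \matrix_(j < #|{: V}|) a (val (enum_val j)).
have Mfree : row_free M.
  apply: affinely_independent_row_free => // c.
  under eq_bigr do rewrite scale_row_mx.
  move=> c0; split.
    have := congr1 (fun A : 'rV[R]_(1 + n) => lsubmx A 0 0) c0.
    rewrite /= linear_sum linear0 /= summxE mxE => E; rewrite -[RHS]E.
    by apply: eq_bigr => v _; rewrite row_mxKl !mxE mulr1.
  rewrite -[LHS]hsubmxK -[RHS]hsubmxK; congr row_mx.
    rewrite !linear_sum big_seq big1 ?linear0 //= => v /V0.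
    by rewrite linearZ /= => ->; rewrite scaler0.
  have := congr1 (@rsubmx _ _ _ _) c0; rewrite !linear_sum !linear0 /=.
  by move=> E; rewrite -[RHS]E; apply: eq_bigr => v _; rewrite row_mxKr linearZ.
have Mfull : row_full M by rewrite /row_full (eqP Mfree) -cardfE Vn.
pose b : 'rV[R]_#|{: V}| := const_mx (n.+1%:R^-1).
have n0 : 0 < n.+1%:R^-1 :> R by rewrite invr_gt0 ltr0n.
(* A displacement of norm at most [1/((n+1)(K+1))] changes each barycentric coordinate by at most
   [K/((n+1)(K+1))], hence by at most [1/(n+1)]. The summand 1 keeps the denominator positive. *)
pose K := \sum_j \sum_l `|pinvmx M j l|.
have K0 : 0 <= K by apply: sumr_ge0 => j _; apply: sumr_ge0.
exists (rsubmx (b *m M : 'rV[R]_(1 + n))), (n.+1%:R^-1 / (K + 1)).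
have K1 : 0 < K + 1 by rewrite ltr_wpDl.
split=> [|t tle]; first by rewrite divr_gt0.
have bM : b *m M = row_mx 1%:M (rsubmx (b *m M : 'rV[R]_(1 + n))).
  rewrite -[LHS]hsubmxK; congr row_mx; apply/rowP => j; rewrite ord1.
  rewrite mxE mxE (eq_bigr (fun=> n.+1%:R^-1)) => [|l _]; last first.
    by rewrite mxE [X in _ * X]mxE row_mxEl mxE eqxx mulr1.
  rewrite sumr_const card_ord -cardfE Vn mxE eqxx.
  by rewrite -[_ *+ _]mulr_natl mulfV // pnatr_eq0.
pose s : 'rV[R]_(1 + n) := row_mx 0 t.
pose c := b + s *m pinvmx M.
have cM : c *m M = row_mx 1%:M (rsubmx (b *m M : 'rV[R]_(1 + n)) + t).
  rewrite mulmxDl mulmxKpV ?submx_full // {1}bM add_row_mx addr0 //.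
have cge0 j : 0 <= c 0 j.
  rewrite !mxE -lerBlDl sub0r; set z := \sum_(_ < _) _.
  suff : `|z| <= n.+1%:R^-1 by rewrite ler_norml => /andP[].
  apply: le_trans (ler_norm_sum _ _ _) _.
  have sle l : `|s 0 l| <= n.+1%:R^-1 / (K + 1).
    rewrite /s -[l]splitK; case: (fintype.split l) => l' /=.
      by rewrite row_mxEl mxE normr0 divr_ge0 ?ltW.
    by rewrite row_mxEr; apply: le_trans (ler_coord_norm _ _ _) tle.
  apply: (@le_trans _ _ (\sum_l n.+1%:R^-1 / (K + 1) * `|pinvmx M l j|)).
    by apply: ler_sum => l _; rewrite normrM ler_wpM2r.
  rewrite -mulr_sumr -[leRHS]mulr1 -mulrA ler_pM2l // ler_pdivrMl // mulr1.
  apply: (@le_trans _ _ K); last by rewrite lerDl.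
  by apply: ler_sum => l _; rewrite (bigD1 j) //= lerDl sumr_ge0.
pose c' v := oapp (fun u : V => c 0 (enum_rank u)) 0 (insub v).
have c'E (u : V) : c' (val u) = c 0 (enum_rank u) by rewrite /c' valK.
have c'M : \sum_(v <- V) c' v *: a v = c *m M.
  rewrite big_seq_fsetE /= mulmx_sum_row.
  rewrite [RHS](reindex enum_rank) /=; last exact: onW_bij (@enum_rank_bij _).
  by apply: eq_bigr => u _; rewrite c'E rowK enum_rankK.
move: c'M; rewrite cM; under eq_bigr do rewrite scale_row_mx.
move=> c'M; exists c'; split.
- by move=> v vV; rewrite /c' insubT /=.
- have := congr1 (fun A : 'rV[R]_(1 + n) => lsubmx A 0 0) c'M.
  rewrite /= row_mxKl linear_sum /= summxE mxE eqxx mulr1n => <-.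
  by apply: eq_bigr => v _; rewrite row_mxKl !mxE mulr1.
rewrite -[RHS]hsubmxK; congr row_mx.
  rewrite linear_sum big_seq big1 //= => v /V0.
  by rewrite linearZ /= => ->; rewrite scaler0.
have := congr1 (@rsubmx _ _ _ _) c'M; rewrite row_mxKr !linear_sum /= => <-.
by apply: eq_bigr => v _; rewrite row_mxKr linearZ.
Qed.

Lemma exists_maximal_superset (T : Type) (s : seq (set T)) g : g \in s ->
  exists2 h, h \in s & g `<=` h /\ forall k, k \in s -> h `<=` k -> k = h.
Proof.
elim: s g => [//|a s IH] g.
have up b : b \in s -> exists2 h, h \in a :: s &
    b `<=` h /\ forall k, k \in a :: s -> h `<=` k -> k = h.
  move=> /IH[h hs [bh hmax]]; have [ha|nha] := pselect (h `<=` a).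
    exists a; first exact: mem_head.
    split=> [|k]; first exact: subset_trans ha.
    rewrite inE => /predU1P[//|ks ak]; apply/seteqP; split=> //.
    by rewrite (hmax k ks) //; apply: subset_trans ak.
  exists h; first by rewrite inE hs orbT.
  by split=> // k; rewrite inE => /predU1P[-> //|/hmax].
rewrite inE => /predU1P[->|/up //].
have [[b bs ab]|nb] := pselect (exists2 b, b \in s & a `<=` b).
  have [h hs [bh hmax]] := up b bs; exists h => //.
  by split=> //; apply: subset_trans bh.
exists a; first exact: mem_head.
split=> // k; rewrite inE => /predU1P[//|ks ak].
by case: nb; exists k.
Qed.

(** An argument about sets ordered by inclusion: a member of [G] that is maximal within the finite
    family [G] is maximal in [Delta], because [G] dominates [Delta]. It serves for the projected
    orange, with [G] the projections of the maximal faces. *)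
Lemma sub_maximal_face (R : realType) m (Delta G : set (set 'rV[R]_m)) sigma :
  finite_set G -> G `<=` Delta ->
  (forall rho, Delta rho -> exists2 g, G g & rho `<=` g) ->
  Delta sigma -> exists2 rho, maximal_face Delta rho & sigma `<=` rho.
Proof.
move=> /finite_seqP[s Gs] GD DG Ds; have [g] := DG _ Ds.
rewrite Gs /= => gs sg; have [h hs [gh hmax]] := exists_maximal_superset gs.
exists h; last exact: subset_trans gh.
split=> [|rho Drho hrho]; first by apply: GD; rewrite Gs.
have [k] := DG _ Drho; rewrite Gs /= => ks rk.
have kh : k = h by apply: hmax => //; apply: subset_trans rk.
by apply/seteqP; split=> //; rewrite -kh.
Qed.

(** * Polynomials and interpolation *)

Section PolynomialFunctions.
Variable R : realType.

Definition peval m (p : mpoly m R) (x : 'rV[R]_m) : R :=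
  meval (fun j => x 0 j) p.

Definition monomial m (e : multinom m) (x : 'rV[R]_m) : R :=
  \prod_(j < m) x 0 j ^+ e j.

Lemma pevalE m k (p : mpoly m R) x : (mpoly.msize p <= k)%N ->
  peval p x = \sum_(e : bmultinom m k) mcoeff e p * monomial e x.
Proof.
move=> pk; rewrite /peval [p in LHS](mpolywE pk) raddf_sum /=.
by apply: eq_bigr => e _; rewrite mevalZ mevalX.
Qed.

Lemma msize_sum_monomials m k (I : finType) (P : pred I) (c : I -> R)
    (e : I -> multinom m) : (forall l, P l -> (mdeg (e l) <= k)%N) ->
  (mpoly.msize (\sum_(l | P l) c l *: mpolyX R (e l)) <= k.+1)%N.
Proof.
move=> ek; apply: leq_trans (mmeasure_sum _ _ _ _) _.
apply/bigmax_leqP => l Pl; apply: leq_trans (msizeZ_le _ _) _.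
by rewrite msizeX ltnS ek.
Qed.

Definition multinom_cat i n (e : multinom i) (f : multinom n) :
    multinom (i + n) :=
  Multinom [tuple match fintype.split j with inl l => e l | inr l => f l end
            | j < i + n].

Definition lmultinom i n (e : multinom (i + n)) : multinom i :=
  Multinom [tuple e (lshift n j) | j < i].

Definition rmultinom i n (e : multinom (i + n)) : multinom n :=
  Multinom [tuple e (rshift i j) | j < n].

Lemma mdeg_multinom_cat i n (e : multinom i) (f : multinom n) :
  mdeg (multinom_cat e f) = (mdeg e + mdeg f)%N.
Proof.
rewrite !mdegE big_split_ord /=; congr addn; apply: eq_bigr => j _.
  by rewrite mnmE (unsplitK (inl _)).
by rewrite mnmE (unsplitK (inr _)).
Qed.

Lemma monomial_multinom_cat i n (e : multinom i) (f : multinom n)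
    (x : 'rV[R]_i) (y : 'rV[R]_n) :
  monomial (multinom_cat e f) (row_mx x y) = monomial e x * monomial f y.
Proof.
rewrite /monomial big_split_ord /=; congr (_ * _); apply: eq_bigr => j _.
  by rewrite mnmE (unsplitK (inl _)) row_mxEl.
by rewrite mnmE (unsplitK (inr _)) row_mxEr.
Qed.

Lemma multinom_splitK i n (e : multinom (i + n)) :
  multinom_cat (lmultinom e) (rmultinom e) = e.
Proof.
apply/mnmP => j; rewrite mnmE -[in RHS](splitK j).
by case: (fintype.split j) => l /=; rewrite mnmE.
Qed.

Lemma mdeg_lrmultinom i n (e : multinom (i + n)) :
  (mdeg (lmultinom e) + mdeg (rmultinom e))%N = mdeg e.
Proof. by rewrite -mdeg_multinom_cat multinom_splitK. Qed.

(** The monomials of [p] are collected by their exponent [a] in the last [n] variables; this leaves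
    degree at most [d - mdeg a] in the first [i]. *)
Lemma peval_split i n d (p : mpoly (i + n) R) : (mpoly.msize p <= d.+1)%N ->
  exists q : bmultinom n d.+1 -> mpoly i R,
    (forall a, mpoly.msize (q a) <= (d - mdeg a).+1)%N /\
    forall x y, peval p (row_mx x y) = \sum_a peval (q a) x * monomial a y.
Proof.
move=> pd.
exists (fun a : bmultinom n d.+1 =>
  \sum_(e : bmultinom (i + n) d.+1 | rmultinom e == a)
  mcoeff e p *: mpolyX R (lmultinom e)); split.
  move=> a; apply: msize_sum_monomials => e /eqP <-.
  have := bmdeg e; rewrite -mdeg_lrmultinom ltnS => ed.
  by rewrite leq_subRL ?(leq_trans (leq_addl _ _) ed) // addnC.
move=> x y; rewrite (pevalE _ pd).
have rd (e : bmultinom (i + n) d.+1) : (mdeg (rmultinom e) < d.+1)%N.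
  apply: leq_ltn_trans (bmdeg e).
  by rewrite -[X in (_ <= X)%N]mdeg_lrmultinom leq_addl.
rewrite (partition_big (fun e => BMultinom (rd e)) xpredT) //=.
apply: eq_bigr => a _; rewrite {1}/peval raddf_sum mulr_suml /=.
apply: eq_big => [e|e /eqP ea]; first by rewrite -val_eqE.
rewrite mevalZ mevalX -mulrA; congr (_ * _).
by rewrite -[in LHS](multinom_splitK e) monomial_multinom_cat -ea.
Qed.

Lemma peval_join i n d k (q : mpoly i R) (a : multinom n) :
  (mpoly.msize q <= k.+1)%N -> (k + mdeg a <= d)%N ->
  exists2 p : mpoly (i + n) R, (mpoly.msize p <= d.+1)%N &
    forall x y, peval p (row_mx x y) = peval q x * monomial a y.
Proof.
move=> qk kd.
exists (\sum_(e : bmultinom i k.+1)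
  mcoeff e q *: mpolyX R (multinom_cat e a)).
  apply: msize_sum_monomials => e _; rewrite mdeg_multinom_cat.
  by apply: leq_trans kd; rewrite leq_add2r -ltnS bmdeg.
move=> x y; rewrite (pevalE _ qk) {1}/peval raddf_sum mulr_suml /=.
apply: eq_bigr => e _; rewrite mevalZ mevalX -mulrA; congr (_ * _).
exact: monomial_multinom_cat.
Qed.

Lemma monomialZ m (e : multinom m) (a : R) x :
  monomial e (a *: x) = a ^+ mdeg e * monomial e x.
Proof.
rewrite /monomial mdegE -prodrXr -big_split /=.
by apply: eq_bigr => j _; rewrite mxE exprMn.
Qed.

(** The Vandermonde matrix of distinct nodes is invertible, so a linear functional on polynomials of
    degree at most [d], prescribed by its values [t a] on the powers, is a combination of
    evaluations at the nodes. *)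
Lemma interpolation_weights d (z t : 'I_d.+1 -> R) : injective z ->
  exists w : 'I_d.+1 -> R, forall a : 'I_d.+1, \sum_b w b * z b ^+ a = t a.
Proof.
move=> zinj; pose V := Vandermonde d.+1 (\row_b z b).
have Vu : V \in unitmx.
  rewrite unitmxE det_Vandermonde unitfE prodf_seq_neq0.
  apply/allP => a _ /=; rewrite prodf_seq_neq0; apply/allP => b _ /=.
  apply/implyP => ab; rewrite !mxE subr_eq0 (inj_eq zinj).
  by apply/eqP => ba; rewrite ba ltnn in ab.
exists (fun b => (invmx V *m \col_a t a) b 0) => a.
transitivity ((V *m (invmx V *m \col_a t a)) a 0); last first.
  by rewrite mulKVmx // mxE.
have VE b : V a b = z b ^+ a by rewrite !mxE.
by rewrite [RHS]mxE; apply: eq_bigr => b _; rewrite VE mulrC.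
Qed.

(** Products of one-variable weights, each dual to a single power, are dual to the monomials on the
    product grid. *)
Lemma multi_interpolation_weights n d (z : 'I_n -> 'I_d.+1 -> R) :
  (forall l, injective (z l)) ->
  exists w : bmultinom n d.+1 -> {ffun 'I_n -> 'I_d.+1} -> R,
    forall a e : bmultinom n d.+1,
      \sum_b w a b * monomial e (\row_l z l (b l)) = (e == a)%:R.
Proof.
move=> zinj.
have /choice[v vE] (la : 'I_n * 'I_d.+1) : exists w : 'I_d.+1 -> R,
    forall e : 'I_d.+1, \sum_b w b * z la.1 b ^+ e = (e == la.2)%:R.
  exact: interpolation_weights.
(* Each exponent is at most the total degree, so [inord] below never takes its default value. *)
have le_d (a : bmultinom n d.+1) l : (a l < d.+1)%N.
  apply: leq_ltn_trans (bmdeg a).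
  by rewrite mdegE (bigD1 l) //= leq_addr.
exists (fun a b => \prod_l v (l, inord (a l)) (b l)) => a e.
transitivity (\prod_l \sum_b v (l, inord (a l)) b * z l b ^+ e l).
  rewrite bigA_distr_bigA /=; apply: eq_bigr => b _.
  rewrite big_split /=; congr (_ * _).
  by apply: eq_bigr => l _; rewrite mxE.
transitivity (\prod_l (e l == a l)%:R : R).
  apply: eq_bigr => l _; have := vE (l, inord (a l)) (inord (e l)).
  by rewrite -val_eqE /= !inordK.
have [->|ea] := eqVneq e a; first by rewrite big1 // => l _; rewrite eqxx.
have [l el] : exists l, e l != a l.
  apply/existsP; rewrite -negb_forall; apply: contra_neqN ea => /forallP ea.
  by apply/val_inj/mnmP => l; apply/eqP.
by rewrite (bigD1 l) //= (negPf el) mul0r.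
Qed.

(* The values at small multiples of [x] determine the value at [x], since a
   polynomial of degree at most [d] in the dilation factor is determined by its
   values at [d.+1] nodes. *)
Lemma interpolation i n d (mu : 'I_d.+1 -> R) (z : 'I_n -> 'I_d.+1 -> R) :
  injective mu -> (forall l, injective (z l)) ->
  exists w : bmultinom n d.+1 -> 'I_d.+1 -> {ffun 'I_n -> 'I_d.+1} -> R,
    forall (q : bmultinom n d.+1 -> mpoly i R) (x : 'rV[R]_i) a,
      (forall e, mpoly.msize (q e) <= d.+1)%N ->
      \sum_s \sum_b w a s b *
        (\sum_e peval (q e) (mu s *: x) * monomial e (\row_l z l (b l))) =
      peval (q a) x.
Proof.
move=> muinj zinj.
(* With target 1 for every exponent, these weights evaluate a polynomial of degree at most [d] at 1,
   which is the extrapolation from the nodes [mu s]. *)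
have [v vE] := interpolation_weights (fun=> 1) muinj.
have [w wE] := multi_interpolation_weights zinj.
exists (fun a s b => v s * w a b) => q x a qd.
transitivity (\sum_s v s * peval (q a) (mu s *: x)).
  apply: eq_bigr => s _; under eq_bigr do rewrite -mulrA.
  rewrite -mulr_sumr; congr (_ * _).
  under eq_bigr do rewrite mulr_sumr.
  rewrite exchange_big /= (bigD1 a) //= [X in _ + X]big1 ?addr0.
    under eq_bigr do rewrite mulrCA.
    by rewrite -mulr_sumr wE eqxx mulr1.
  move=> e ea; under eq_bigr do rewrite mulrCA.
  by rewrite -mulr_sumr wE (negPf ea) mulr0.
under eq_bigr => s _ do rewrite (pevalE _ (qd a)) mulr_sumr.
rewrite exchange_big (pevalE _ (qd a)) /=; apply: eq_bigr => e _.
under eq_bigr => s _ do rewrite monomialZ [mcoeff _ _ * _]mulrCA (mulrA (v s)).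
rewrite -[RHS]mul1r -mulr_suml; congr (_ * _).
by rewrite -(vE (Ordinal (bmdeg e))).
Qed.

End PolynomialFunctions.

(** * Splines *)

Section SplineSpaces.
Variables (R : realType) (m : nat).
Implicit Types Delta : set (set 'rV[R]_m).

Lemma spline0 r d Delta : spline r d Delta 0.
Proof.
split=> [a|sigma _].
  exists setT, (fun=> 0); split=> //; first exact: openT.
  exact: Cr_on_cst.
exists 0; split=> [|x _]; first by rewrite mmeasure0.
by rewrite meval0.
Qed.

Lemma spline_linear r d Delta (a : R) (u v : polyhedron Delta -> R^o) :
  spline r d Delta u -> spline r d Delta v -> spline r d Delta (a *: u + v).
Proof.
move=> [Cu pu] [Cv pv]; split=> [x|sigma smax].
  have [U [g [oU Ux Cg ug]]] := Cu x; have [W [h [oW Wx Ch vh]]] := Cv x.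
  have oUW : open (U `&` W) by apply: openI.
  exists (U `&` W), (fun x => a * g x + h x); split=> //.
    apply: Cr_onD => //; last by apply: Cr_on_subset Ch => ? [].
    apply: Cr_onM => //; first exact: Cr_on_cst.
    by apply: Cr_on_subset Cg => ? [].
  by move=> z [Uz Wz]; rewrite -ug // -vh.
have [p [pd pE]] := pu _ smax; have [q [qd qE]] := pv _ smax.
exists (a *: p + q); split=> [|x sx].
  apply: leq_trans (mmeasureD_le _ _ _) _; rewrite geq_max qd andbT.
  exact: leq_trans (msizeZ_le _ _) pd.
by rewrite mevalD mevalZ -pE // -qE.
Qed.

(** One maximal face is chosen around every point. The monomials cut off to the regions of constant
    choice span a finite-dimensional space of functions, in general not splines, that contains every
    spline. *)
Lemma spline_finite_dim r d Delta :
  finite_set (maximal_face Delta) ->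
  (forall x, polyhedron Delta x -> exists2 sigma,
    maximal_face Delta sigma & sigma x) ->
  finite_dim (spline r d Delta).
Proof.
move=> /finite_seqP[s sE] cover.
have /choice[cell cellP] (x : polyhedron Delta) :
    exists c : 'I_(size s), (nth set0 s c) (val x).
  have [sigma] := cover _ (set_mem (valP x)); rewrite sE /= => ss sx.
  have cs : (index sigma s < size s)%N by rewrite index_mem.
  by exists (Ordinal cs); rewrite /= nth_index.
have smax (c : 'I_(size s)) : maximal_face Delta (nth set0 s c).
  by rewrite sE /= mem_nth.
pose e (cb : 'I_(size s) * bmultinom m d.+1) : polyhedron Delta -> R^o :=
  fun x => (cb.1 == cell x)%:R * monomial cb.2 (val x).
apply: (@finite_dim_sub_span _ _ _ _ e); first exact: spline0.
  exact: spline_linear.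
move=> f [_ fp].
have /choice[p pP] (c : 'I_(size s)) : exists p : mpoly m R,
    (mpoly.msize p <= d.+1)%N /\
    forall x : polyhedron Delta, nth set0 s c (val x) -> f x = peval p (val x).
  by have [p pP] := fp _ (smax c); exists p.
exists (fun cb : 'I_(size s) * bmultinom m d.+1 => mcoeff cb.2 (p cb.1)).
apply/funext => x.
rewrite fct_sumE -(pair_bigA _ (fun c (b : bmultinom m d.+1) =>
  (mcoeff b (p c) *: e (c, b)) x)) /=.
rewrite (bigD1 (cell x)) //= [X in _ + X]big1 ?addr0; last first.
  move=> c cx; apply: big1 => b _.
  change (mcoeff b (p c) * ((c == cell x)%:R * monomial b (val x)) = 0).
  by rewrite (negPf cx) mul0r mulr0.
rewrite ((pP _).2 _ (cellP x)) (pevalE _ (pP _).1); apply: eq_bigr => b _.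
change (mcoeff b (p (cell x)) * monomial b (val x) = mcoeff b (p (cell x)) *
  ((cell x == cell x)%:R * monomial b (val x))).
by rewrite eqxx mul1r.
Qed.

End SplineSpaces.

Lemma lipschitz_continuous_rV (R : realType) m n
    (A : 'rV[R]_m -> 'rV[R]_n) (K : R) : 0 <= K ->
  (forall x y, `|A x - A y| <= K * `|x - y|) -> continuous A.
Proof.
move=> K0 AK x; have K1 : 0 < K + 1 by rewrite ltr_wpDl.
apply: (proj2 (@cvgrPdist_lt _ _ _ (nbhs x) _ A (A x))) => e e0; near=> y.
apply: le_lt_trans (AK _ _) _.
apply: (@le_lt_trans _ _ ((K + 1) * `|x - y|)).
  by rewrite ler_wpM2r // lerDl.
rewrite -ltr_pdivlMl // mulrC; near: y.
apply/nbhs_ballP; exists (e / (K + 1)); first by rewrite /= divr_gt0.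
by move=> z; rewrite -ball_normE.
Unshelve. all: by end_near. Qed.

Lemma norm_row_mx (R : realType) i n (x : 'rV[R]_i) (y : 'rV[R]_n) :
  `|row_mx x y| = Num.max `|x| `|y|.
Proof.
apply/eqP; rewrite eq_le; apply/andP; split.
  apply: norm_le_coord => [|j l]; first by rewrite le_max normr_ge0.
  rewrite ord1 -[l]splitK; case: (fintype.split l) => l' /=.
    by rewrite row_mxEl le_max ler_coord_norm.
  by rewrite row_mxEr le_max ler_coord_norm orbT.
have := norm_rsubmx (row_mx x y); have := norm_lsubmx (row_mx x y).
by rewrite row_mxKl row_mxKr ge_max => -> ->.
Qed.

(* The point [(mu x, y + t)] is the barycenter, with weights [mu] and
   [1 - mu], of a point of [sigma] above [x] and a point of [tau]. *)
Lemma maximal_face_near_medial (R : realType) i n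
    (O : set (set 'rV[R]_(i + n))) (tau : set 'rV[R]_(i + n))
    (y : 'rV[R]_n) (e : R) :
  simplicial_complex O -> finite_set (maximal_face O) ->
  (forall sigma, maximal_face O sigma -> tau `<=` sigma) ->
  0 < e -> (forall t : 'rV[R]_n, `|t| <= e -> tau (row_mx 0 (y + t))) ->
  exists (M dl : R), [/\ 0 <= M, 0 < dl &
    forall sigma, maximal_face O sigma -> forall p, sigma p -> `|p| <= M /\
      forall (mu : R) (t : 'rV[R]_n), 0 <= mu <= dl -> `|t| <= dl ->
        sigma (row_mx (mu *: lsubmx p) (y + t))].
Proof.
move=> cO /finite_seqP[s sE] tauS e0 tauB.
have hullO sigma : maximal_face O sigma -> exists V, sigma = hull V.
  by move=> [/(complex_simplex cO)[k [V [_ _ ->]]] _]; exists V.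
have /choice[B BP] (sigma : set 'rV[R]_(i + n)) : exists b : R,
    maximal_face O sigma -> forall p, sigma p -> `|p| <= b.
  have [/hullO[V ->]|ns] := pselect (maximal_face O sigma).
    by have [b bV] := hull_bounded V; exists b.
  by exists 0.
pose M := \sum_(sigma <- s) `|B sigma|.
have M0 : 0 <= M by apply: sumr_ge0.
have MP sigma p : maximal_face O sigma -> sigma p -> `|p| <= M.
  move=> smax sp; apply: le_trans (BP _ smax _ sp) _.
  have ss : sigma \in s by move: smax; rewrite sE.
  apply: le_trans (ler_norm _) _; rewrite /M.
  elim: s ss {sE M M0} => [//|a s IH]; rewrite inE big_cons => /predU1P[->|/IH].
    by rewrite lerDl sumr_ge0.
  by move=> /le_trans; apply; rewrite lerDr.
pose N := 1 + `|y| + M.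
have N0 : 0 < N by rewrite /N; have := normr_ge0 y; lra.
(* This radius [dl] satisfies [dl < 1/2], so [1 - mu > 1/2], and [dl * N <= e/2], where [dl * N]
   bounds the norm of [t + mu (y - y-part of p)]. *)
exists M, (e / (2 * (N + e))); split=> //.
  by rewrite divr_gt0 // mulr_gt0 // addr_gt0.
set dl := e / _ => sigma smax p sp; split; first exact: MP sp.
have NE0 : 0 < 2 * (N + e) by rewrite mulr_gt0 // addr_gt0.
have dlE : dl * (2 * (N + e)) = e by rewrite /dl divfK // gt_eqF.
have dl0 : 0 < dl by rewrite /dl divr_gt0.
have dl2 : dl < 1 / 2 by rewrite /dl ltr_pdivrMr //; lra.
move=> mu t /andP[mu0 mudl] tdl.
have mu1 : 0 < 1 - mu by lra.
have [V sV] := hullO _ smax; move: (sp); rewrite sV => hp.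
(* The point [q] is obtained by solving [mu p + (1 - mu) q = (mu x, y + t)] with [x = lsubmx p]. *)
pose q : 'rV[R]_(i + n) :=
  row_mx 0 (y + (1 - mu)^-1 *: (t + mu *: (y - rsubmx p))).
have hq : hull V q.
  rewrite -sV; apply: tauS => //; apply: tauB.
  rewrite normrZ gtr0_norm ?invr_gt0 // ler_pdivrMl //.
  apply: le_trans (ler_normD _ _) _; rewrite normrZ (ger0_norm mu0).
  have yp : `|y - rsubmx p| <= `|y| + M.
    apply: le_trans (ler_normB _ _) _; rewrite lerD2l.
    exact: le_trans (norm_rsubmx _) (MP _ _ smax sp).
  have h1 : mu * `|y - rsubmx p| <= dl * (`|y| + M).
    by apply: ler_pM => //; apply: normr_ge0.
  have h2 : 1 / 2 * e <= (1 - mu) * e by rewrite ler_pM2r //; lra.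
  have h3 : 0 <= dl * e by rewrite mulr_ge0 ?ltW.
  have h4 : dl * N = dl + dl * (`|y| + M) by rewrite /N -addrA mulrDr mulr1.
  have h5 : 2 * (dl * N) + 2 * (dl * e) = e by rewrite -[RHS]dlE; lra.
  lra.
have := hull_convex (_ : 0 <= mu <= 1) hp hq.
rewrite -sV; set u := _ + _.
have -> : u = row_mx (mu *: lsubmx p) (y + t).
  rewrite /u -{1}[p]hsubmxK !scale_row_mx add_row_mx scaler0 addr0.
  congr row_mx; rewrite scalerDr scalerA mulfV ?gt_eqF // scale1r.
  rewrite scalerBr scalerBl scale1r.
  set a := mu *: y; set b := mu *: rsubmx p.
  by rewrite addrCA addrA addrAC; apply/matrixP => j l; rewrite !mxE; lra.
apply; apply/andP; lra.
Qed.

(** * The projected orange and the lifting of its splines *)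

Section ProjectedOrange.
Variables (R : realType) (i n : nat) (ik : (i <= i + n)%N).
Variable O : set (set 'rV[R]_(i + n)).

Lemma coord_projE (x : 'rV[R]_(i + n)) : coord_proj ik x = lsubmx x.
Proof.
by apply/rowP => j; rewrite !mxE; congr (x _ _); apply: val_inj.
Qed.

Lemma projected_orangeE :
  projected_orange ik O = [set lsubmx @` sigma | sigma in O].
Proof.
rewrite /projected_orange; congr image; apply/funext => sigma.
by congr image; apply/funext => x; rewrite coord_projE.
Qed.

Lemma polyhedron_proj x :
  polyhedron O x -> polyhedron (projected_orange ik O) (lsubmx x).
Proof.
move=> [sigma Os sx]; exists (lsubmx @` sigma); last by exists x.
by rewrite projected_orangeE; exists sigma.
Qed.

Definition poly_proj (x : polyhedron O) : polyhedron (projected_orange ik O) :=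
  SigSub (mem_set (polyhedron_proj (set_mem (valP x)))).

Definition lift_spline (a : multinom n)
    (f : polyhedron (projected_orange ik O) -> R^o) : polyhedron O -> R^o :=
  fun x => f (poly_proj x) * monomial a (rsubmx (val x)).

Lemma lift_spline_is_linear a : linear (lift_spline a).
Proof.
move=> c f g; apply/funext => x.
change ((c * f (poly_proj x) + g (poly_proj x)) * monomial a (rsubmx (val x)) =
  c * (f (poly_proj x) * monomial a (rsubmx (val x))) +
  g (poly_proj x) * monomial a (rsubmx (val x))).
by rewrite mulrDl mulrA.
Qed.

HB.instance Definition _ a := GRing.isLinear.Build R _ _ _ (lift_spline a)
  (lift_spline_is_linear a).

Hypothesis cO : simplicial_complex O.
Hypothesis finO : finite_set (maximal_face O).

(** Every member of the projected orange lies in a member of this finite family, which therefore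
    contains all its maximal members. *)
Let G : set (set 'rV[R]_i) := [set lsubmx @` sigma | sigma in maximal_face O].

Let finG : finite_set G. Proof. exact: finite_image. Qed.

Let C_sub_G rho : projected_orange ik O rho -> exists2 g, G g & rho `<=` g.
Proof.
rewrite projected_orangeE => -[sigma Os <-].
have [sigma' smax ss'] := complex_sub_maximal_face cO Os.
by exists (lsubmx @` sigma'); [exists sigma'|apply: image_subset].
Qed.

Let G_sub_C : G `<=` projected_orange ik O.
Proof. by rewrite projected_orangeE => _ [sigma [Os _] <-]; exists sigma. Qed.

Lemma finite_maximal_face_proj :
  finite_set (maximal_face (projected_orange ik O)).
Proof.
apply: sub_finite_set finG => rho [Crho rmax].
have [g Gg rg] := C_sub_G Crho.
by rewrite -(rmax g) //; apply: G_sub_C.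
Qed.

Lemma proj_sub_maximal_face sigma : maximal_face O sigma ->
  exists2 rho, maximal_face (projected_orange ik O) rho &
    lsubmx @` sigma `<=` rho.
Proof.
move=> smax; apply: (sub_maximal_face finG) => //.
by apply: G_sub_C; exists sigma.
Qed.

Lemma maximal_face_cover x : polyhedron O x ->
  exists2 sigma, maximal_face O sigma & sigma x.
Proof.
move=> [sigma Os sx]; have [rho rmax sr] := complex_sub_maximal_face cO Os.
by exists rho => //; apply: sr.
Qed.

Lemma proj_cover x : polyhedron (projected_orange ik O) x ->
  exists sigma p, [/\ maximal_face O sigma, sigma p & x = lsubmx p].
Proof.
move=> [rho Crho rx]; have [g [sigma smax <-] rg] := C_sub_G Crho.
by have [p sp <-] := rg _ rx; exists sigma, p.
Qed.

Lemma spline_proj_finite_dim r d :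
  finite_dim (spline r d (projected_orange ik O)).
Proof.
apply: spline_finite_dim; first exact: finite_maximal_face_proj.
move=> x /proj_cover[sigma [p [smax sp ->]]].
have [rho rmax sr] := proj_sub_maximal_face smax.
by exists rho => //; apply: sr; exists p.
Qed.

Lemma continuous_lsubmx : continuous (lsubmx : 'rV[R]_(i + n) -> 'rV[R]_i).
Proof.
apply: (@lipschitz_continuous_rV _ _ _ _ 1) => // x y.
by rewrite mul1r -linearB norm_lsubmx.
Qed.

(** A local extension pulled back along the projection and multiplied by the monomial is an
    extension on an open cylinder. On a maximal face the monomial restores the [mdeg a] missing
    degrees. *)
Lemma lift_spline_spline r d (a : bmultinom n d.+1) f :
  spline r (d - mdeg a) (projected_orange ik O) f ->
  spline r d O (lift_spline a f).
Proof.
move=> [fC fp]; split=> [x|sigma smax].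
  have [U [g [oU Ux Cg fg]]] := fC (poly_proj x).
  have oU' : open (lsubmx @^-1` U : set 'rV[R]_(i + n)).
    by apply: open_comp => // z _; apply: continuous_lsubmx.
  exists (lsubmx @^-1` U), (fun z => g (lsubmx z) * monomial a (rsubmx z)).
  split=> //; last by move=> z Uz; rewrite /lift_spline fg.
  apply: Cr_onM => //; last first.
    apply: Cr_on_prod => // l; apply: Cr_onX => //.
    apply: Cr_on_ext (Cr_on_coord r _ (rshift i l)) => z.
    by rewrite mxE.
  apply: Cr_on_comp => //; first exact: continuous_lsubmx.
  move=> j; rewrite -[j]splitK; case: (fintype.split j) => l /=.
    right; exists 1, l; split=> [|h z]; first exact: oner_neq0.
    by apply/rowP => b; rewrite !mxE mulr1 -!val_eqE.
  left=> h z; apply/rowP => b; rewrite !mxE /=.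
  by rewrite -!val_eqE /= ltn_eqF ?mulr0 ?add0r ?andbF // ltn_addr.
have [rho rmax sr] := proj_sub_maximal_face smax.
have [q [qd qE]] := fp _ rmax.
have ad : (d - mdeg a + mdeg a <= d)%N by rewrite subnK // -ltnS bmdeg.
have [p pd pE] := peval_join qd ad.
exists p; split=> // x sx.
rewrite -[RHS]/(peval p (val x)) -[X in peval p X]hsubmxK pE.
rewrite /lift_spline qE //.
by apply: sr; exists (val x).
Qed.

(** * Recovery of the coefficient splines from values near a medial point *)

Variables (d : nat) (y : 'rV[R]_n) (M dl : R).
Hypothesis M0 : 0 <= M.
Hypothesis dl0 : 0 < dl.
Hypothesis Oy : polyhedron O (row_mx 0 y).
Hypothesis near_y : forall sigma, maximal_face O sigma ->
  forall p, sigma p -> `|p| <= M /\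
    forall (mu : R) (t : 'rV[R]_n), 0 <= mu <= dl -> `|t| <= dl ->
      sigma (row_mx (mu *: lsubmx p) (y + t)).

(** Equally spaced points of the interval from 0 to [e]. The shift [s.+1] excludes 0, since the
    dilation factors must be nonzero for [Cr_on_comp]. *)
Let node (e : R) (s : 'I_d.+1) : R := e * (s.+1%:R / d.+1%:R).

Let node_gt0 e s : 0 < e -> 0 < node e s.
Proof. by move=> e0; rewrite /node mulr_gt0 // divr_gt0 // ltr0n. Qed.

Let node_le e s : 0 < e -> node e s <= e.
Proof.
move=> e0; rewrite /node ler_piMr ?(ltW e0) // ler_pdivrMr ?ltr0n // mul1r.
by rewrite ler_nat.
Qed.

Let node_inj e : 0 < e -> injective (node e).
Proof.
move=> e0 s t /(mulfI (lt0r_neq0 e0)).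
have d0 : d.+1%:R^-1 != 0 :> R by rewrite invr_eq0 pnatr_eq0.
move=> /(mulIf d0) /eqP; rewrite eqr_nat => /eqP[].
exact: val_inj.
Qed.

Let grid (e : R) (b : {ffun 'I_n -> 'I_d.+1}) : 'rV[R]_n :=
  \row_l node e (b l).

Let norm_grid e b : 0 < e -> `|grid e b| <= e.
Proof.
move=> e0; apply: norm_le_coord => [|j l]; first exact: ltW.
by rewrite mxE gtr0_norm ?node_gt0 // node_le.
Qed.

(** Interpolation on the grid translated by [y]. The weights are chosen before the polynomials [q]
    and the point [x], so the same ones work on all maximal faces. *)
Let recovery e : 0 < e ->
  exists w : bmultinom n d.+1 -> 'I_d.+1 -> {ffun 'I_n -> 'I_d.+1} -> R,
    forall (q : bmultinom n d.+1 -> mpoly i R) (x : 'rV[R]_i) a,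
      (forall c, mpoly.msize (q c) <= d.+1)%N ->
      \sum_s \sum_b w a s b * (\sum_c peval (q c) (node e s *: x) *
        monomial c (y + grid e b)) = peval (q a) x.
Proof.
move=> e0.
have zinj l : injective (fun s => y 0 l + node e s).
  by move=> s t /addrI /(node_inj e0).
have [w wE] := interpolation i (node_inj e0) zinj.
exists w => q x a qd; rewrite -[RHS](wE q x a qd).
apply: eq_bigr => s _; apply: eq_bigr => b _; congr (_ * _).
apply: eq_bigr => c _; congr (_ * monomial c _).
by apply/rowP => l; rewrite !mxE.
Qed.

Let face_node sigma p e s b : maximal_face O sigma -> sigma p ->
  0 < e -> e <= dl ->
  sigma (row_mx (node e s *: lsubmx p) (y + grid e b)).
Proof.
move=> smax sp e0 edl; have [_ near_p] := near_y smax sp; apply: near_p.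
  by rewrite (ltW (node_gt0 _ e0)) (le_trans (node_le _ e0)).
exact: le_trans (norm_grid _ e0) edl.
Qed.

(** The sample points used to recover [F a] at [x] all lie in one maximal face [sigma] above [x],
    and project into one maximal [rho], on which each [F c] is a single polynomial. The sum vanishes
    at every sample, so the recovered value is 0. *)
Lemma lift_spline_inj r
    (F : bmultinom n d.+1 -> polyhedron (projected_orange ik O) -> R^o) :
  (forall a : bmultinom n d.+1,
    spline r (d - mdeg a) (projected_orange ik O) (F a)) ->
  \sum_(a : bmultinom n d.+1) lift_spline a (F a) = 0 -> forall a, F a = 0.
Proof.
move=> FS F0 a; apply/funext => x.
have [sigma [p [smax sp xp]]] := proj_cover (set_mem (valP x)).
have [rho rmax sr] := proj_sub_maximal_face smax.
have /choice[q qP] c : exists q : mpoly i R, (mpoly.msize q <= d.+1)%N /\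
    forall z : polyhedron (projected_orange ik O),
      rho (val z) -> F c z = peval q (val z).
  have [q [qd qE]] := (FS c).2 _ rmax; exists q; split=> //.
  by apply: leq_trans qd _; rewrite ltnS leq_subr.
have [w wE] := recovery dl0.
rewrite (qP a).2; last by rewrite xp; apply: sr; exists p.
rewrite -(wE q _ a (fun c => (qP c).1)).
rewrite big1 // => s _; rewrite big1 // => b _.
have sP := face_node s b smax sp dl0 (lexx _).
set P := row_mx _ _ in sP.
have OP : polyhedron O P by exists sigma => //; apply: smax.1.
pose Px : polyhedron O := SigSub (mem_set OP).
have := congr1 (fun g : polyhedron O -> R^o => g Px) F0.
rewrite fct_sumE => F0P; rewrite [X in _ * X](_ : _ = 0) ?mulr0 //.
rewrite -[RHS]F0P; apply: eq_bigr => c _.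
rewrite /lift_spline /= row_mxKr; congr (_ * _).
rewrite (qP c).2 /= ?row_mxKl ?xp //.
by apply: sr; exists P => //; rewrite row_mxKl.
Qed.

Lemma spline_lift_decomposition r f : spline r d O f ->
  exists2 F : bmultinom n d.+1 -> polyhedron (projected_orange ik O) -> R^o,
    forall a : bmultinom n d.+1,
      spline r (d - mdeg a) (projected_orange ik O) (F a) &
    f = \sum_(a : bmultinom n d.+1) lift_spline a (F a).
Proof.
move=> [fC fp].
have [U [g [oU Uy Cg fg]]] := fC (SigSub (mem_set Oy)).
have [eta eta0 etaU] : exists2 eta : R, 0 < eta &
    forall z : 'rV[R]_(i + n), `|row_mx 0 y - z| < eta -> U z.
  have /nbhs_ballP[eta eta0 etaU] := open_nbhs_nbhs (conj oU Uy).
  by exists eta => // z yz; apply: etaU; rewrite -ball_normE.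
(* The bound [e <= dl] keeps sample points in the face they come from, and [e * (M + 2) <= eta]
   keeps them in [U] for all [x] of norm less than [M + 1]. As [M] bounds the points of the orange,
   that ball is a neighbourhood of the whole projected orange. *)
pose e := Num.min dl (eta / (M + 2)).
have M2 : 0 < M + 2 by rewrite ltr_wpDl.
have e0 : 0 < e by rewrite lt_min dl0 divr_gt0.
have edl : e <= dl by rewrite ge_min lexx.
have eeta : e * (M + 2) <= eta.
  by rewrite -ler_pdivlMr // ge_min lexx orbT.
have eM : 0 <= e * M by rewrite mulr_ge0 // ltW.
have nodeU s b (x : 'rV[R]_i) : `|x| < M + 1 ->
    U (row_mx (node e s *: x) (y + grid e b)).
  move=> xM; apply: etaU; rewrite opp_row_mx add_row_mx sub0r norm_row_mx.
  rewrite gt_max normrN normrZ opprD addrA subrr sub0r normrN.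
  apply/andP; split; last by apply: le_lt_trans (norm_grid _ e0) _; lra.
  rewrite gtr0_norm ?node_gt0 //.
  apply: (@le_lt_trans _ _ (e * (M + 1))); last lra.
  by apply: ler_pM => //; rewrite ?node_le ?(ltW (node_gt0 _ e0)) ?(ltW xM).
have [w wE] := recovery e0.
(* This function is defined from [g] alone, without reference to faces, so a single smooth extension
   serves all of them. *)
pose h a (x : 'rV[R]_i) := \sum_s \sum_b w a s b *
  g (row_mx (node e s *: x) (y + grid e b)).
have Ux : open (ball (0 : 'rV[R]_i) (M + 1)) by apply: ball_open.
have Ch a : Cr_on r (ball (0 : 'rV[R]_i) (M + 1)) (h a).
  apply: Cr_on_sum => // s; apply: Cr_on_sum => // b.
  apply: Cr_onM => //; first exact: Cr_on_cst.
  pose A (x : 'rV[R]_i) := row_mx (node e s *: x) (y + grid e b).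
  apply: (@Cr_on_subset _ _ _ (A @^-1` U)).
    by move=> x; rewrite -ball_normE /= sub0r normrN; apply: nodeU.
  apply: (Cr_on_comp (A := A)) => //.
    apply: (@lipschitz_continuous_rV _ _ _ _ (node e s)).
      by rewrite ltW ?node_gt0.
    move=> x z; rewrite opp_row_mx add_row_mx subrr norm_row_mx normr0.
    rewrite -scalerBr normrZ gtr0_norm ?node_gt0 // ge_max lexx.
    by rewrite mulr_ge0 // ltW ?node_gt0.
  move=> j; right; exists (node e s), (lshift n j).
  split=> [|t x]; first by rewrite gt_eqF ?node_gt0.
  apply/rowP => l; rewrite -[l]splitK; case: (fintype.split l) => l' /=.
    by rewrite /A !mxE !(unsplitK (inl _)) !mxE -!val_eqE /=; lra.
  rewrite /A !mxE !(unsplitK (inr _)) !mxE -!val_eqE /=.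
  by rewrite gtn_eqF ?mulr0 ?add0r // ltn_addr.
have hE sigma : maximal_face O sigma ->
    exists q : bmultinom n d.+1 -> mpoly i R, [/\
      forall a : bmultinom n d.+1, (mpoly.msize (q a) <= (d - mdeg a).+1)%N,
      forall (x : polyhedron O), sigma (val x) -> f x =
        \sum_(a : bmultinom n d.+1)
          peval (q a) (lsubmx (val x)) * monomial a (rsubmx (val x)) &
      forall a p, sigma p -> h a (lsubmx p) = peval (q a) (lsubmx p)].
  move=> smax; have [P [Pd PE]] := fp _ smax.
  have [q [qd qE]] := peval_split Pd; exists q; split=> //.
    by move=> x sx; rewrite -qE hsubmxK; apply: PE.
  move=> a p sp; rewrite -(wE q); last first.
    by move=> c; apply: leq_trans (qd c) _; rewrite ltnS leq_subr.
  apply: eq_bigr => s _; apply: eq_bigr => b _; congr (_ * _).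
  rewrite -qE; have sz := face_node s b smax sp e0 edl.
  set z := row_mx _ _ in sz *.
  have Oz : polyhedron O z by exists sigma => //; apply: smax.1.
  transitivity (f (SigSub (mem_set Oz))); last exact: PE.
  apply/esym/fg/nodeU.
  have [pM _] := near_y smax sp.
  by apply: le_lt_trans (norm_lsubmx _) _; lra.
exists (fun a x => h a (val x)).
  move=> a; split=> [x|rho [Crho rmax]].
    exists (ball 0 (M + 1)), (h a); split=> //.
    have [sigma [p [smax sp ->]]] := proj_cover (set_mem (valP x)).
    have [pM _] := near_y smax sp; rewrite -ball_normE /= sub0r normrN.
    by apply: le_lt_trans (norm_lsubmx _) _; lra.
  (* A maximal member of the projected orange lies in the projection of some maximal face, whose
     coefficient polynomial then represents [h a] on it. *)
  have [_ [sigma smax <-] rs] := C_sub_G Crho.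
  have [q [qd _ qE]] := hE _ smax; exists (q a); split=> // x rx.
  by have [p sp px] := rs _ rx; rewrite -px qE.
apply/funext => x.
have [sigma smax sx] := maximal_face_cover (set_mem (valP x)).
have [q [_ fE qE]] := hE _ smax.
rewrite fE // fct_sumE; apply: eq_bigr => a _.
by rewrite /lift_spline /= qE.
Qed.

Lemma has_dim_spline r :
  has_dim (spline r d O) (\sum_(0 <= j < d.+1)
    binz (d%:Z + n%:Z - j%:Z - 1) (n%:Z - 1) *
    dimension (spline r j (projected_orange ik O)))%N.
Proof.
rewrite -sum_bmultinom.
apply: (@has_dim_bigsum _ _ _ _ (fun a : bmultinom n d.+1 => lift_spline a)
  (fun a : bmultinom n d.+1 => spline r (d - mdeg a) (projected_orange ik O))).
- move=> a; have [k kdim] := spline_proj_finite_dim r (d - mdeg a).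
  by rewrite (dimensionE kdim).
- move=> F FS; elim/big_ind: _ => [|u v Su Sv|a _]; first exact: spline0.
    by rewrite -[u]scale1r; apply: spline_linear.
  exact: lift_spline_spline.
- exact: spline_lift_decomposition.
- exact: lift_spline_inj.
Qed.

End ProjectedOrange.

(** * The dimension formula *)

Theorem theorem1p2 (R : realType) (k i r d : nat) (ik : (i <= k)%N)
    (rd : (r <= d)%N) (O : set (set 'rV[R]_k)) (tau : set 'rV[R]_k)
    (hO : orange i O) (htau : medial_simplex i O tau)
    (tau0 : forall x, tau x -> forall j : 'I_k, (j < i)%N -> x 0 j = 0) :
  [/\ finite_dim (spline r d O),
      forall j : nat, (j <= d)%N -> finite_dim (spline r j (projected_orange ik O)) &
      dimension (spline r d O) =
        (\sum_(0 <= j < d.+1)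
           binz (d%:Z + k%:Z - i%:Z - j%:Z - 1) (k%:Z - i%:Z - 1) *
           dimension (spline r j (projected_orange ik O)))%N].
Proof.
have [n kE] : exists n, k = (i + n)%N by exists (k - i)%N; rewrite subnKC.
subst k; have [cO _ finO _] := hO.
have [Otau [V [indV Vn tauV]] taumax] := htau.
(* The medial simplex has dimension [n] and lies in the [n]-dimensional subspace where the first [i]
   coordinates vanish, so it contains a ball of that subspace. *)
have [|v vV|y [e [e0 eB]]] := @simplex_relative_ball R i n V indV.
- by rewrite Vn addKn.
- apply/rowP => j; rewrite !mxE; apply: tau0; last by rewrite /= ltn_ord.
  by rewrite tauV; apply: hull_vertex.
rewrite -tauV in eB.
have [M [dl [M0 dl0 near_y]]] := maximal_face_near_medial cO finO taumax e0 eB.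
have Oy : polyhedron O (row_mx 0 y).
  by exists tau => //; rewrite -[y]addr0; apply: eB; rewrite normr0 ltW.
have dimO := has_dim_spline ik cO finO d M0 dl0 Oy near_y r.
split; first by eexists; exact: dimO.
  by move=> j _; apply: spline_proj_finite_dim.
rewrite (dimensionE dimO); apply: eq_bigr => j _; congr (binz _ _ * _)%N; lia.
Qed.
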